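(* Let $X\in\mathbb{R}^{n\times d}$, $y\in\mathbb{R}^n$, $\gamma\in(0,1)$, let $P\in\mathbb{R}^{n\times n}$ be a row-stochastic matrix, and let $D\in\mathbb{R}^{n\times n}$ be the diagonal matrix carrying a stationary distribution of $P$ on its diagonal. Put $r=(I-\gamma P)y$, $A=X^\top D(I-\gamma P)X$ and $b=X^\top D r$. If $D$ has full support (all its diagonal entries are positive) and $X$ has linearly independent rows, then TD and OLS have the same minimum norm solution, i.e. the minimum Euclidean norm solution $w_{TD}$ of $Aw=b$ equals the minimum Euclidean norm minimizer $w_{LS}$ of $\|Xw-y\|_2^2$. Moreover, any solution $w\in\mathbb{R}^d$ of the linear system $Xw=y$ is also a solution of TD's linear system $Aw=b$.
   Context: The $n$ training points $(x_i,y_i)$, where $x_i^\top$ is the $i$-th row of $X$, are regarded as the states of a Markov reward process with transition matrix $P$ and discount factor $\gamma$; the label $y_i$ is regarded as the value of state $i$, so the reward vector is $r=(I-\gamma P)y$. The (linear) TD solution is obtained from the linear system $Aw=b$, with minimum norm solution $w_{TD}=A^{\dagger}b$; OLS (ordinary least squares) minimizes $\|Xw-y\|_2^2$, with minimum norm solution $w_{LS}=X^{\dagger}y$. Here $\dagger$ denotes the Moore–Penrose pseudoinverse. *)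

(* Defs.v *)
From HB Require Import structures.
From mathcomp Require Import all_boot all_order all_algebra.
From mathcomp Require Import reals.

Set Implicit Arguments.
Unset Strict Implicit.
Unset Printing Implicit Defensive.

Import Order.TTheory GRing.Theory Num.Theory.
Local Open Scope ring_scope.

Definition row_stochastic (R : realFieldType) n (P : 'M[R]_n) : Prop :=
  (forall i j, 0 <= P i j) /\ (forall i, \sum_j P i j = 1).

Definition stationary_distribution (R : realFieldType) n
    (P : 'M[R]_n) (mu : 'rV[R]_n) : Prop :=
  [/\ forall i, 0 <= mu 0 i, \sum_i mu 0 i = 1 & mu *m P = mu].

(* The norm [`|v|] that MathComp-Analysis puts on matrices is the sup norm. *)
Definition enorm (R : rcfType) n (v : 'cV[R]_n) : R :=
  Num.sqrt (\sum_i v i 0 ^+ 2).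

Definition linear_solution (R : rcfType) m n
    (A : 'M[R]_(m, n)) (b : 'cV[R]_m) (w : 'cV[R]_n) : Prop :=
  A *m w = b.

Definition least_squares_solution (R : rcfType) m n
    (A : 'M[R]_(m, n)) (b : 'cV[R]_m) (w : 'cV[R]_n) : Prop :=
  forall v : 'cV[R]_n, enorm (A *m w - b) ^+ 2 <= enorm (A *m v - b) ^+ 2.

Definition min_norm (R : rcfType) n
    (S : 'cV[R]_n -> Prop) (w : 'cV[R]_n) : Prop :=
  S w /\ (forall v, S v -> enorm w <= enorm v).

(* MathComp's [pinvmx] is only some generalized inverse, not in general the
   Moore-Penrose one; the latter is characterized by Penrose's equations. *)
Definition penrose (R : realFieldType) m n
    (A : 'M[R]_(m, n)) (B : 'M[R]_(n, m)) : bool :=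
  [&& A *m B *m A == A, B *m A *m B == B,
      (A *m B)^T == A *m B & (B *m A)^T == B *m A].

Lemma gram_unitmx (R : realFieldType) m n (F : 'M[R]_(m, n)) :
  row_free F -> F *m F^T \in unitmx.
Proof.
move=> fF; rewrite -row_free_unit -kermx_eq0; apply/eqP/row_matrixP => i.
rewrite row0; set u := row i _.
have : u *m (F *m F^T) = 0 by apply/sub_kermxP; rewrite row_sub.
move=> /(congr1 (fun M => M *m u^T)); rewrite mul0mx mulmxA -mulmxA -trmx_mul.
move=> /matrixP /(_ 0 0); rewrite !mxE => s0.
have uF0 : u *m F = 0.
  apply/rowP => j; rewrite [RHS]mxE; apply/eqP; rewrite -sqrf_eq0.
  have ge0 k : true -> 0 <= (u *m F) 0 k * (u *m F)^T k 0.
    by rewrite [_^T _ _]mxE -expr2 sqr_ge0.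
  have /eqP := s0; rewrite psumr_eq0 // => /allP /(_ j).
  by rewrite mem_index_enum [_^T _ _]mxE -expr2; apply.
by apply: (row_free_inj fF); rewrite uF0 mul0mx.
Qed.

Lemma penrose_exists (R : realFieldType) m n (A : 'M[R]_(m, n)) :
  exists B, penrose A B.
Proof.
have [r [C [F [eA fC fF]]]] : exists r (C : 'M[R]_(m, r)) (F : 'M[R]_(r, n)),
    [/\ A = C *m F, row_full C & row_free F].
  exists (\rank A), (col_base A), (row_base A).
  by rewrite mulmx_base row_base_free col_base_full.
have uF : F *m F^T \in unitmx by exact: gram_unitmx.
have uC : C^T *m C \in unitmx.
  by rewrite -{2}[C]trmxK; apply: gram_unitmx; rewrite /row_free mxrank_tr.
pose G := F^T *m invmx (F *m F^T); pose H := invmx (C^T *m C) *m C^T.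
have FG : F *m G = 1%:M by rewrite /G mulmxA mulmxV.
have HC : H *m C = 1%:M by rewrite /H -mulmxA mulVmx.
have AB : A *m (G *m H) = C *m H.
  by rewrite eA mulmxA -(mulmxA C) FG mulmx1.
have BA : G *m H *m A = G *m F.
  by rewrite eA -mulmxA (mulmxA H) HC mul1mx.
exists (G *m H); apply/and4P; split; apply/eqP.
- by rewrite AB {1}eA -mulmxA (mulmxA H) HC mul1mx.
- by rewrite BA -mulmxA (mulmxA F) FG mul1mx.
- by rewrite AB /H !trmx_mul trmx_inv trmx_mul trmxK mulmxA.
- by rewrite BA /G !trmx_mul trmx_inv trmx_mul trmxK mulmxA.
Qed.

Definition mpinv (R : realFieldType) m n (A : 'M[R]_(m, n)) : 'M[R]_(n, m) :=
  xchoose (penrose_exists A).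

Lemma mpinvP (R : realFieldType) m n (A : 'M[R]_(m, n)) : penrose A (mpinv A).
Proof. exact: xchooseP. Qed.

Lemma penrose_unique (R : realFieldType) m n (A : 'M[R]_(m, n)) B C :
  penrose A B -> penrose A C -> B = C.
Proof.
move=> /and4P[/eqP B1 /eqP B2 /eqP B3 /eqP B4].
move=> /and4P[/eqP C1 /eqP C2 /eqP C3 /eqP C4].
have AB : A *m B = A *m C.
  have e : A *m B = (A *m C) *m (A *m B) by rewrite [RHS]mulmxA C1.
  by rewrite -B3 e trmx_mul B3 C3 mulmxA B1.
have BA : B *m A = C *m A.
  have e : B *m A = (B *m A) *m (C *m A) by rewrite -mulmxA (mulmxA A) C1.
  by rewrite -B4 e trmx_mul B4 C4 -mulmxA (mulmxA A) B1.
by rewrite -B2 BA -mulmxA AB mulmxA C2.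
Qed.

(* Main.v *)
Require Import Defs.
From HB Require Import structures.
From mathcomp Require Import all_boot all_order all_algebra.
From mathcomp Require Import reals.

Set Implicit Arguments.
Unset Strict Implicit.

Import Order.TTheory GRing.Theory Num.Theory.
Local Open Scope ring_scope.

(** Since [X] has full row rank, both [X^T] and [X] can be cancelled on the
    appropriate side.  The matrix [D (I - gamma P)] is invertible: [D] has
    positive diagonal, and a vector [u = gamma P u] vanishes because its largest
    entry in absolute value is at most [gamma] times itself.  Hence the TD
    system, the least-squares problem and [X w = y] all have the same, nonempty
    solution set, and the pseudoinverse selects its unique element of minimal
    norm. *)

Lemma enorm_ge0 (R : rcfType) n (v : 'cV[R]_n) : 0 <= enorm v.
Proof. exact: sqrtr_ge0. Qed.

Lemma enorm_sqr (R : rcfType) n (v : 'cV[R]_n) :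
  enorm v ^+ 2 = \sum_i v i 0 ^+ 2.
Proof. by rewrite sqr_sqrtr // sumr_ge0 // => i _; exact: sqr_ge0. Qed.

Lemma enorm0 (R : rcfType) n : enorm (0 : 'cV[R]_n) = 0.
Proof. by rewrite /enorm big1 ?sqrtr0 // => i _; rewrite mxE expr0n. Qed.

Lemma enorm_sqr_eq0 (R : rcfType) n (v : 'cV[R]_n) :
  enorm v ^+ 2 = 0 -> v = 0.
Proof.
rewrite enorm_sqr => /eqP; rewrite psumr_eq0 => [|i _]; last exact: sqr_ge0.
move=> /allP v0; apply/colP => i; rewrite mxE; apply/eqP; rewrite -sqrf_eq0.
by apply: v0; rewrite mem_index_enum.
Qed.

Lemma enorm_sqrD (R : rcfType) n (u v : 'cV[R]_n) :
  u^T *m v = 0 -> enorm (u + v) ^+ 2 = enorm u ^+ 2 + enorm v ^+ 2.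
Proof.
move=> /matrixP /(_ 0 0); rewrite !mxE => uv0.
have {}uv0 : \sum_i u i 0 * v i 0 = 0.
  by rewrite -[RHS]uv0; apply: eq_bigr => i _; rewrite mxE.
rewrite !enorm_sqr; under eq_bigr do rewrite mxE sqrrD mulr2n.
by rewrite !big_split /= uv0 !addr0.
Qed.

Lemma eq_min_norm (R : rcfType) n (S T : 'cV[R]_n -> Prop) w :
  (forall v, S v <-> T v) -> min_norm S w <-> min_norm T w.
Proof.
by move=> ST; split=> -[Sw min_w]; (split; first exact/ST) => v /ST /min_w.
Qed.

Lemma eq_unique_min_norm (R : rcfType) n (S T : 'cV[R]_n -> Prop) w :
  (forall v, S v <-> T v) -> unique (min_norm S) w -> unique (min_norm T) w.
Proof.
move=> ST [min_w uniq_w]; split=> [|v /(eq_min_norm _ ST)]; last exact: uniq_w.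
exact/(eq_min_norm _ ST).
Qed.

(** The witness [w0] puts [b] in the range of [A], so [A *m mpinv A] fixes [b]. Pythagoras then
    gives both minimality and uniqueness: a competitor of equal norm has [enorm (v - p) = 0]. *)
Lemma mpinv_unique_min_norm (R : rcfType) m n (A : 'M[R]_(m, n))
    (b : 'cV[R]_m) (w0 : 'cV[R]_n) :
  A *m w0 = b -> unique (min_norm (linear_solution A b)) (mpinv A *m b).
Proof.
move=> Aw0; have /and4P[/eqP ABA _ _ /eqP BAT] := mpinvP A.
set p := mpinv A *m b.
have Ap : A *m p = b by rewrite /p -Aw0 !mulmxA ABA.
(* A solution splits orthogonally as [p] plus an element of [ker A]. *)
have pyth v : A *m v = b -> enorm v ^+ 2 = enorm p ^+ 2 + enorm (v - p) ^+ 2.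
  move=> Av; rewrite -enorm_sqrD ?[p + _]addrC ?subrK //.
  (* Being symmetric, [mpinv A *m A] moves across the inner product onto [v - p], which [A]
     kills. *)
  have -> : p = mpinv A *m A *m v by rewrite /p -Av mulmxA.
  rewrite trmx_mul BAT mulmxBr -!mulmxA Av.
  by rewrite -/p Ap subrr.
have min_p v : linear_solution A b v -> enorm p <= enorm v.
  move=> /pyth; rewrite -(ler_pXn2r (ltn0Sn 1)) ?nnegrE ?enorm_ge0 // => ->.
  by rewrite lerDl sqr_ge0.
split=> // v [Av min_v]; apply/esym/eqP; rewrite -subr_eq0; apply/eqP.
apply: enorm_sqr_eq0; have := pyth v Av.
have -> : enorm v = enorm p by apply/eqP; rewrite eq_le min_v // min_p.
by move/eqP; rewrite -subr_eq0 opprD addrA subrr add0r oppr_eq0 => /eqP.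
Qed.

(** For a consistent system the least residual is zero, attained at [w0]. *)
Lemma least_squares_linear_solution (R : rcfType) m n (A : 'M[R]_(m, n))
    (b : 'cV[R]_m) (w0 w : 'cV[R]_n) :
  A *m w0 = b -> least_squares_solution A b w <-> linear_solution A b w.
Proof.
move=> Aw0; split=> [/(_ w0)|Aw v].
  rewrite Aw0 subrr enorm0 expr0n => le0.
  apply/eqP; rewrite -subr_eq0; apply/eqP/enorm_sqr_eq0/eqP.
  by rewrite eq_le le0 sqr_ge0.
by rewrite Aw subrr enorm0 expr0n sqr_ge0.
Qed.

Lemma row_free_solvable (R : realFieldType) m n (A : 'M[R]_(m, n))
    (b : 'cV[R]_m) :
  row_free A -> A *m (A^T *m invmx (A *m A^T) *m b) = b.
Proof. by move=> fA; rewrite !mulmxA mulmxV ?mul1mx // gram_unitmx. Qed.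

(** [kermx] is the left kernel, so the argument for column vectors goes through the transpose. *)
Lemma unitmx_ker0 (F : fieldType) n (M : 'M[F]_n) :
  (forall u : 'cV_n, M *m u = 0 -> u = 0) -> M \in unitmx.
Proof.
move=> ker0; rewrite -unitmx_tr -row_free_unit -kermx_eq0; apply/eqP.
apply/row_matrixP => i; rewrite row0 -[LHS]trmxK [X in X^T]ker0 ?trmx0 //.
apply: trmx_inj; rewrite trmx_mul trmxK trmx0.
by apply/sub_kermxP; rewrite row_sub.
Qed.

Lemma discounted_stochastic_unitmx (R : realFieldType) n (P : 'M[R]_n)
    (gamma : R) :
  row_stochastic P -> 0 < gamma < 1 -> 1%:M - gamma *: P \in unitmx.
Proof.
move=> [P0 P1] /andP[g0 g1]; apply: unitmx_ker0 => u.
rewrite mulmxBl mul1mx -scalemxAl => /eqP; rewrite subr_eq0 => /eqP uE.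
apply/colP => i0; rewrite [RHS]mxE.
have [i _ maxi] := @arg_maxP _ _ _ i0 xpredT (fun i => `|u i 0|) isT.
have le_ui : `|u i 0| <= gamma * `|u i 0|.
  rewrite {1}uE mxE mxE normrM gtr0_norm // ler_pM2l //.
  rewrite (le_trans (ler_norm_sum _ _ _)) //.
  (* The factor 1 is expanded as the sum of row [i] of [P], for a termwise comparison. *)
  rewrite -[leRHS]mul1r -(P1 i) mulr_suml ler_sum // => j _.
  by rewrite normrM ger0_norm // ler_wpM2l //; exact: maxi.
have ui0 : `|u i 0| <= 0.
  rewrite -(pmulr_rle0 _ (_ : 0 < 1 - gamma)) ?subr_gt0 //.
  by rewrite mulrBl mul1r subr_le0.
by apply/eqP; rewrite -normr_le0 (le_trans (maxi i0 isT) ui0).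
Qed.

Lemma diag_mx_unitmx (F : fieldType) n (v : 'rV[F]_n) :
  (forall i, v 0 i != 0) -> diag_mx v \in unitmx.
Proof.
by move=> v0; rewrite unitmxE det_diag unitfE; apply/prodf_neq0 => i _.
Qed.

(** Multiplying by [A] on the left turns [A^T] into the invertible Gram matrix [A *m A^T], which
    cancels, and then so does [M]. *)
Lemma projected_linear_solution (R : rcfType) m n (A : 'M[R]_(m, n))
    (M : 'M[R]_m) (b : 'cV[R]_m) (w : 'cV[R]_n) :
  row_free A -> M \in unitmx ->
  linear_solution (A^T *m M *m A) (A^T *m M *m b) w <-> linear_solution A b w.
Proof.
move=> fA uM; rewrite /linear_solution; split=> [|<-]; last by rewrite mulmxA.
move=> /(congr1 (mulmx A)); rewrite -!mulmxA !(mulmxA A A^T).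
move=> /(can_inj (mulKmx (gram_unitmx fA))).
exact: (can_inj (mulKmx uM)).
Qed.

Unset Implicit Arguments.
Set Strict Implicit.

Theorem proposition4p1 (R : realType) (n d : nat)
    (X : 'M[R]_(n, d)) (y : 'cV[R]_n) (gamma : R)
    (P : 'M[R]_n) (mu : 'rV[R]_n)
    (hgamma : 0 < gamma < 1)
    (hP : row_stochastic P)
    (hmu : stationary_distribution P mu)
    (hsupp : forall i, 0 < mu 0 i)
    (hX : row_free X) :
  let D := diag_mx mu in
  let r := (1%:M - gamma *: P) *m y in
  let A := X^T *m D *m (1%:M - gamma *: P) *m X in
  let b := X^T *m D *m r in
  let w_TD := mpinv A *m b in
  let w_LS := mpinv X *m y in
  [/\ unique (min_norm (linear_solution A b)) w_TD,
      unique (min_norm (least_squares_solution X y)) w_LS,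
      w_TD = w_LS
    & forall w : 'cV[R]_d, linear_solution X y w -> linear_solution A b w].
Proof.
move=> D r A b w_TD w_LS.
have uM : D *m (1%:M - gamma *: P) \in unitmx.
  rewrite unitmx_mul discounted_stochastic_unitmx // andbT.
  by apply: diag_mx_unitmx => i; rewrite gt_eqF.
have solE w : linear_solution A b w <-> linear_solution X y w.
  (* Since [r] is [y] multiplied by [1%:M - gamma *: P], both sides of the TD system share the left
     factor [X^T *m M] with [M = D *m (1%:M - gamma *: P)]. *)
  rewrite /A /b /r [X in linear_solution _ X]mulmxA -(mulmxA _ D).
  exact: projected_linear_solution.
have Xw0 := row_free_solvable y hX.
have uniq_LS : unique (min_norm (linear_solution X y)) w_LS.
  exact: mpinv_unique_min_norm Xw0.
have uniq_TD : unique (min_norm (linear_solution A b)) w_TD.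
  by apply: mpinv_unique_min_norm; apply/solE; exact: Xw0.
split=> //.
- apply: eq_unique_min_norm uniq_LS => w; apply: iff_sym.
  exact: least_squares_linear_solution Xw0.
(* Transported along [solE], [w_TD] is the unique minimum norm solution of [X *m w = y], as is
   [w_LS]. *)
- by case: (eq_unique_min_norm solE uniq_TD) => _; apply; case: uniq_LS.
- by move=> w /solE.
Qed.
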